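(* Let $p$ be an odd prime, $m,s$ positive integers, and $\mathcal{R}=\mathbb{F}_{p^m}[u,v]/\langle u^2,v^2,uv-vu\rangle$. Let $\alpha=\alpha_1+\alpha_2u+\alpha_3v+\alpha_4uv\in\mathcal{R}$ with $\alpha_1,\alpha_2,\alpha_3\in\mathbb{F}_{p^m}^*$, $\alpha_4\in\mathbb{F}_{p^m}$, and suppose $\alpha$ is not a square in $\mathcal{R}$. Let $\alpha_0\in\mathbb{F}_{p^m}$ be the element with $\alpha_0^{p^s}=\alpha_1$. Let $\mathcal{C}=\langle u(x^2-\alpha_0)^\ell\rangle$ be the ideal of $\mathcal{R}_\alpha=\mathcal{R}[x]/\langle x^{2p^s}-\alpha\rangle$, where $0\le\ell\le 2p^s-1$. Then the (minimum) symbol-pair distance of $\mathcal{C}$ is $$d_{sp}(\mathcal{C})=\begin{cases}2 & \text{if } 0\le\ell\le p^s;\\ 2(\Gamma+1)p^{\gamma} & \text{if } 2p^s-p^{s-\gamma}+(\Gamma-1)p^{s-\gamma-1}+1\le\ell\le 2p^s-p^{s-\gamma}+\Gamma p^{s-\gamma-1},\\ & \text{where } 1\le\Gamma\le p-1 \text{ and } 0\le\gamma\le s-1.\end{cases}$$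
   Context: Elements of $\mathcal{R}_\alpha=\mathcal{R}[x]/\langle x^{2p^s}-\alpha\rangle$ are identified with vectors in $\mathcal{R}^{2p^s}$: the class whose representative of degree less than $2p^s$ is $\zeta_0+\zeta_1x+\cdots+\zeta_{2p^s-1}x^{2p^s-1}$ corresponds to $(\zeta_0,\ldots,\zeta_{2p^s-1})$. Ideals of $\mathcal{R}_\alpha$ are thereby the $\alpha$-constacyclic codes of length $2p^s$ over $\mathcal{R}$. For vectors $x=(x_0,\ldots,x_{n-1})$, $y=(y_0,\ldots,y_{n-1})$ over an alphabet, the symbol-pair distance is $d_{sp}(x,y)=|\{i:0\le i\le n-1,\ (x_i,x_{i+1})\ne(y_i,y_{i+1})\}|$, indices taken modulo $n$; for a code $\mathcal{C}$ with at least two words, $d_{sp}(\mathcal{C})=\min\{d_{sp}(x,y):x,y\in\mathcal{C},x\ne y\}$. *)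

(* Defs.v *)
From HB Require Import structures.
From mathcomp Require Import all_boot all_order all_algebra.
From mathcomp Require Import boolp.

Set Implicit Arguments.
Unset Strict Implicit.
Unset Printing Implicit Defensive.

Import GRing.Theory.
Local Open Scope ring_scope.
Local Open Scope quotient_scope.

(* Ideal membership is not decidable in general: [asbool] turns the defining
   proposition into the boolean predicate expected by [{ideal_quot _}]. *)
Definition ideal_gen (A : comNzRingType) (gs : seq A) : {pred A} :=
  fun f => `[< exists a : 'I_(size gs) -> A, f = \sum_i a i * gs`_i >].

(* F[u,v] is {poly {poly F}}, i.e. F[u][v]. *)
Definition uv_relations (F : fieldType) : seq {poly {poly F}} :=
  let u : {poly {poly F}} := 'X%:P in
  let v : {poly {poly F}} := 'X in
  [:: u ^+ 2; v ^+ 2; u * v - v * u].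

Definition uv_ideal (F : fieldType) : {poly {poly F}} -> bool :=
  ideal_gen (uv_relations F).

Lemma uv_ideal_idealr (F : fieldType) : idealr_closed (@uv_ideal F).
Proof.
split.
- by apply/asboolP; exists (fun=> 0); rewrite big1 // => i _; rewrite mul0r.
- apply/asboolP => -[a] /(congr1 (fun f : {poly {poly F}} => f.[0].[0])).
  rewrite !horner_sum big1 ?hornerC => [/eqP|[[|[|[|//]]] ? _] /=];
    first by rewrite oner_eq0.
  + by rewrite expr2 !hornerM hornerC hornerX !mulr0.
  + by rewrite hornerM hornerXn expr0n mulr0 horner0.
  + by rewrite ['X * _]mulrC subrr mulr0 !horner0.
move=> b f g /asboolP[a1 ->] /asboolP[a2 ->]; apply/asboolP.
exists (fun i => b * a1 i + a2 i).
by rewrite mulr_sumr -big_split; apply: eq_bigr => i _; rewrite mulrDl mulrA.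
Qed.

HB.instance Definition _ (F : fieldType) :=
  isIdealr.Build {poly {poly F}} (@uv_ideal F) (@uv_ideal_idealr F).

Definition uv_idealr (F : fieldType) : idealr {poly {poly F}} := @uv_ideal F.

(* F[u,v]/<u^2, v^2, uv - vu> *)
Definition ringR (F : fieldType) : comNzRingType := {ideal_quot uv_idealr F}.

Definition embR (F : fieldType) (a : F) : ringR F :=
  \pi_({ideal_quot uv_idealr F}) a%:P%:P.
Definition uR (F : fieldType) : ringR F :=
  \pi_({ideal_quot uv_idealr F}) 'X%:P.
Definition vR (F : fieldType) : ringR F :=
  \pi_({ideal_quot uv_idealr F}) 'X.

(* [{poly %/ h}] reduces modulo [mk_monic h], which is [h] when [h] is monic of
   positive degree, as is the case here for [0 < n]. *)
Notation consta_ring n alpha := {poly %/ 'X^n - alpha%:P}.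

(* Elements of [{poly %/ h}] are the representatives of degree less than that
   of [h], so their coefficients are the coordinates of the codeword. *)
Definition consta_code (R : comNzRingType) (n : nat) (alpha : R)
    (I : {pred consta_ring n alpha}) : 'rV[R]_n -> Prop :=
  fun w => exists2 c : consta_ring n alpha,
             c \in I & w = poly_rV (c : {poly R}).

(* [ordS i] is [i + 1] modulo [n]. *)
Definition sp_dist (R : eqType) (n : nat) (x y : 'rV[R]_n) : nat :=
  #|[set i : 'I_n | (x 0 i, x 0 (ordS i)) != (y 0 i, y 0 (ordS i))]|.

Definition is_min_sp_dist (R : eqType) (n : nat) (C : 'rV[R]_n -> Prop)
    (d : nat) : Prop :=
  (exists x y, [/\ C x, C y, x <> y & sp_dist x y = d]) /\
  (forall x y, C x -> C y -> x <> y -> (d <= sp_dist x y)%N).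

(* Main.v *)
(** Since (x^2 - alpha0)^(p^s) equals alpha2 u + alpha3 v + alpha4 uv in the
    quotient, its product with u is alpha3 uv.  So for l = p^s + k with k >= 0
    the code consists of the words uv f with f over F of degree < 2 p^s and
    divisible by (x^2 - alpha0)^k; when l <= p^s, it contains the word uv of
    Hamming weight 1.  The even and odd parts of such an f are divisible by
    (x - alpha0)^k; a nonzero part has its support on positions of one parity,
    so each of its w nonzero entries meets two pairs of its own and the pair
    weight of f is at least 2 w.

    It remains to bound below the number of terms of a nonzero h of degree < p^s
    divisible by (x - a)^k.  Split h by exponents modulo p into sections
    x^r h_r(x^p), and let c be the number of nonzero h_r.  Applying x d/dx - r'
    for all other nonzero sections r' isolates x^r h_r(x^p) and costs at most
    c - 1 in the multiplicity at a.  Hence every nonzero h_r has at a^p a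
    multiplicity m with k < p m + c, and h has at least c times as many terms as
    its sparsest nonzero section: an induction on s gives the bound, which
    (x - a)^(p^s - p^(s - gamma) + Gamma p^(s - gamma - 1)) attains. *)
Require Import Defs.
From HB Require Import structures.
From mathcomp Require Import all_boot all_order all_algebra.
From mathcomp Require Import finfield boolp zify.

Set Implicit Arguments.
Unset Strict Implicit.
Unset Printing Implicit Defensive.

Import GRing.Theory.
Local Open Scope ring_scope.

(** * Number of terms of a multiple of a power of X - a *)

Section Weight.
Variable F : fieldType.
Implicit Types (f g h q : {poly F}) (a c : F).

(** The Hamming weight, as a sum over naturals so that the range can be extended or regrouped. *)
Definition wt f : nat := (\sum_(0 <= i < size f) (f`_i != 0)%R)%N.

Lemma wtE n f : (size f <= n)%N -> wt f = (\sum_(0 <= i < n) (f`_i != 0)%R)%N.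
Proof.
move=> le_fn; rewrite /wt (big_cat_nat (leq0n _) le_fn) /=.
rewrite [X in _ = (_ + X)%N]big_nat_cond [X in _ = (_ + X)%N]big1 ?addn0 // => i.
by rewrite andbT => /andP[lefi _]; rewrite nth_default ?eqxx.
Qed.

Lemma wt_gt0 f : f != 0 -> (0 < wt f)%N.
Proof.
move=> nz_f; rewrite /wt; have : (0 < size f)%N by rewrite size_poly_gt0.
case Ef: (size f) => [//|n] _; rewrite big_nat_recr //= -[n]/(n.+1.-1) -Ef.
by rewrite -/(lead_coef f) lead_coef_eq0 nz_f addn1.
Qed.

Lemma wt_le_size f : (wt f <= size f)%N.
Proof.
apply: (@leq_trans (\sum_(0 <= i < size f) 1)).
  by apply: leq_sum => i _; apply: leq_b1.
by rewrite sum_nat_const_nat subn0 muln1.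
Qed.

Lemma wtD f g : (wt (f + g) <= wt f + wt g)%N.
Proof.
pose n := maxn (size f) (size g).
rewrite (@wtE n (f + g)) ?size_polyD // (@wtE n f) ?leq_maxl //.
rewrite (@wtE n g) ?leq_maxr // -big_split /=; apply: leq_sum => i _.
rewrite coefD; have [->|_] := eqVneq (f`_i)%R 0%R; first by rewrite add0r.
by rewrite (leq_trans (leq_b1 _)).
Qed.

Lemma wtZ c f : wt (c *: f) = ((c != 0)%R * wt f)%N.
Proof.
rewrite (@wtE (size f)) ?size_scale_leq // /wt big_distrr /=.
by apply: eq_bigr => i _; rewrite coefZ mulf_eq0 negb_or mulnb.
Qed.

Lemma wt_cons f c : wt (f * 'X + c%:P) = (wt f + (c != 0)%R)%N.
Proof.
rewrite (@wtE (size f).+1); last first.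
  by rewrite size_MXaddC; case: ifP.
rewrite big_nat_recl // addnC coefD coefMX coefC eqxx add0r; congr (_ + _)%N.
by apply: eq_bigr => i _; rewrite coefD coefMX coefC /= addr0.
Qed.

Lemma wtMXn f n : wt (f * 'X^n) = wt f.
Proof.
elim: n => [|n IHn]; first by rewrite mulr1.
by rewrite exprSr mulrA -[X in wt X]addr0 -polyC0 wt_cons eqxx addn0.
Qed.

(** Horner induction on [f]: each nonzero coefficient adds one shifted multiple of [g]. *)
Lemma wtM f g : (wt (f * g) <= wt f * wt g)%N.
Proof.
elim/poly_ind: f g => [|f c IHf] g.
  by rewrite mul0r /wt size_poly0 big_geq.
rewrite wt_cons mulrDl mulnDl -mulrA mul_polyC -wtZ ['X * g]mulrC.
by apply: leq_trans (wtD _ _) _; rewrite leq_add2r -[wt g](wtMXn _ 1).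
Qed.

(** Only an inequality, because for [n = 0] the composition collapses to a constant. *)
Lemma wt_comp_Xn f n : (wt (f \Po 'X^n) <= wt f)%N.
Proof.
elim/poly_ind: f => [|f c IHf]; first by rewrite comp_poly0.
rewrite comp_polyD comp_polyM comp_polyX comp_polyC wt_cons.
apply: leq_trans (wtD _ _) _; rewrite wtMXn leq_add // -[c%:P]alg_polyC wtZ.
by rewrite (leq_trans (leq_mul (leqnn _) (wt_le_size _))) // size_poly1 muln1.
Qed.

(** * Sections of a polynomial by exponents modulo [d] *)

Definition sect d r f := \poly_(j < size f) f`_(j * d + r).

Lemma coef_sect d r f j : (0 < d)%N -> (sect d r f)`_j = f`_(j * d + r).
Proof.
move=> d_gt0; rewrite coef_poly; case: ltnP => // lefj.
rewrite nth_default // (leq_trans lefj) // (leq_trans _ (leq_addr _ _)) //.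
exact: leq_pmulr.
Qed.

Lemma size_sect d r f n : (0 < d)%N ->
  (size f <= d * n)%N -> (size (sect d r f) <= n)%N.
Proof.
move=> d_gt0 le_f; apply/leq_sizeP => j le_nj; rewrite coef_sect //.
rewrite nth_default // (leq_trans le_f) // (leq_trans _ (leq_addr _ _)) //.
by rewrite mulnC leq_mul2r le_nj orbT.
Qed.

Lemma wt_sect d f : (0 < d)%N -> wt f = (\sum_(0 <= r < d) wt (sect d r f))%N.
Proof.
move=> d_gt0; rewrite (@wtE (size f * d)) ?leq_pmulr //.
under [RHS]eq_bigr do rewrite (@wtE (size f)) ?size_poly //.
rewrite exchange_big big_nat_mul /=; apply: eq_bigr => j _.
rewrite -{1}[(j * d)%N]add0n mulSn big_addn addnK.
by apply: eq_bigr => r _; rewrite coef_sect // addnC.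
Qed.

(** The residue of the degree works: that section contains the leading coefficient. *)
Lemma sect_neq0 d f : (0 < d)%N -> f != 0 ->
  exists2 r, (r < d)%N & sect d r f != 0.
Proof.
move=> d_gt0 nz_f; exists ((size f).-1 %% d)%N; first by rewrite ltn_mod.
apply: contraNneq nz_f => /(congr1 (fun g : {poly F} => g`_((size f).-1 %/ d))).
by rewrite coef_sect // -divn_eq coef0 => /eqP; rewrite lead_coef_eq0.
Qed.

Lemma wt_card n f : (size f <= n)%N -> #|[set i : 'I_n | f`_i != 0]| = wt f.
Proof.
move=> le_f; rewrite (wtE le_f) big_mkord -sum1dep_card big_mkcond.
by apply: eq_bigr => i _; case: (_ == 0).
Qed.

Lemma wt_sect_card d r n f : (r < d)%N -> (size f <= d * n)%N ->
  (wt (sect d r f)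
     <= #|[set i : 'I_(d * n) | (i %% d == r)%N && (f`_i != 0)%R]|)%N.
Proof.
move=> lt_rd le_f; have d_gt0 : (0 < d)%N by apply: leq_ltn_trans lt_rd.
have lt_j (j : 'I_n) : (j * d + r < d * n)%N.
  rewrite mulnC; apply: (@leq_trans (d * j + d)); first by rewrite ltn_add2l.
  by rewrite -mulnSr leq_pmul2l.
rewrite -(wt_card (size_sect r d_gt0 le_f)).
have inj_j : injective (fun j => Ordinal (lt_j j)).
  move=> i j /(congr1 val) /= /addIn/eqP.
  by rewrite eqn_pmul2r // => /eqP/val_inj.
rewrite -(card_imset _ inj_j); apply: subset_leq_card; apply/subsetP => i.
case/imsetP => j; rewrite !inE coef_sect // => nz ->.
by rewrite /= modnMDl modn_small // eqxx.
Qed.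

(** Multiplication by ['X^d] only shifts each section by one place, so taking a section is linear
    over polynomials in ['X^d]. *)
Lemma sect_comp_XnM d r q h : (r < d)%N ->
  sect d r ((q \Po 'X^d) * h) = q * sect d r h.
Proof.
move=> lt_rd; have d_gt0 : (0 < d)%N by apply: leq_ltn_trans lt_rd.
elim/poly_ind: q h => [|q c IHq] h.
  by rewrite comp_poly0 !mul0r; apply/polyP => j; rewrite coef_sect // !coef0.
rewrite comp_polyD comp_polyM comp_polyX comp_polyC !mulrDl -!mulrA.
have sectD f g : sect d r (f + g) = sect d r f + sect d r g.
  by apply/polyP => j; rewrite coefD !coef_sect // coefD.
rewrite sectD IHq; congr (q * _ + _); apply/polyP => j; last first.
  by rewrite coef_sect // !coefCM coef_sect.
rewrite coefXM !coef_sect // coefXnM.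
case: j => [|j] /=; first by rewrite lt_rd.
by rewrite mulSn -addnA ltnNge leq_addr /= addKn.
Qed.

(* The operator [x d/dx - r] multiplies the coefficient of [x^n] by [n - r] and
   lowers the multiplicity of a root by at most one. *)
Lemma dvdp_kill a K (rs : seq nat) f g :
  (forall n, g`_n = f`_n * \prod_(r <- rs) (n%:R - r%:R)) ->
  ('X - a%:P) ^+ K %| f -> ('X - a%:P) ^+ (K - size rs) %| g.
Proof.
elim: rs K f g => [|r rs IHrs] K f g def_g dv_f.
  suff ->: g = f by rewrite subn0.
  by apply/polyP => n; rewrite def_g big_nil mulr1.
rewrite /= -add1n subnDA.
apply: (IHrs _ ('X * f^`() - r%:R *: f)) => [n|].
  rewrite def_g big_cons mulrA; congr (_ * _).
  rewrite coefB coefXM coefZ coef_deriv; case: n => [|n] /=.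
    by rewrite !sub0r mulrN mulrC.
  by rewrite mulrBr mulr_natr [_ * r%:R]mulrC.
case: K dv_f => [|K]; first by move=> _; rewrite sub0n expr0 dvd1p.
case/dvdpP => h ->; rewrite subSS subn0.
have dvK q : ('X - a%:P) ^+ K %| q * ('X - a%:P) ^+ K.+1.
  by rewrite exprSr mulrA dvdp_mulr // dvdp_mulIr.
rewrite dvdp_sub // -?mul_polyC ?mulrA // dvdp_mull // derivM dvdp_add //.
by rewrite deriv_exp -mulrnAl mulrA dvdp_mulIr.
Qed.

(** * Multiplicities and weights in characteristic [p] *)

Section PrimeChar.
Variables (p : nat) (pF : p \in [pchar F]).

Let p_prime : prime p. Proof. exact: pcharf_prime pF. Qed.
Let p_gt0 : (0 < p)%N. Proof. exact: prime_gt0. Qed.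

Lemma exp_XnsubC n a e :
  ('X^n - a%:P) ^+ (p ^ e) = 'X^(n * p ^ e) - (a ^+ (p ^ e))%:P.
Proof.
have pP : [pchar {poly F}].-nat (p ^ e)%N.
  rewrite pnatX; apply/orP; left; rewrite pnatE // pchar_poly; exact: pF.
by rewrite exprDn_pchar // exprNn_pchar // -exprM rmorphXn.
Qed.

Lemma natF_inj r n : (r < p)%N -> (n < p)%N -> (r%:R == n%:R :> F) = (r == n).
Proof.
wlog le_rn : r n / (r <= n)%N => [IH lt_r lt_n|lt_r lt_n].
  by case/orP: (leq_total r n) => le_rn; [|rewrite eq_sym [RHS]eq_sym]; apply: IH.
rewrite eq_sym -subr_eq0 -natrB // -(dvdn_pcharf pF) eq_sym eqn_leq le_rn /=.
rewrite -subn_eq0; case E: (n - r)%N => [|m]; first by rewrite dvdn0.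
by rewrite gtnNdvd // -E (leq_ltn_trans (leq_subr _ _)).
Qed.

Definition nzsect f := [seq r <- iota 0 p | sect p r f != 0].

(* Applying [x d/dx - r'] for every other nonzero section [r'] isolates the
   section [r] of [f]. *)
Lemma dvdp_sect a k f r : a != 0 -> ('X - a%:P) ^+ k %| f ->
  r \in nzsect f ->
  exists2 m, ('X - (a ^+ p)%:P) ^+ m %| sect p r f
           & (k < p * m + size (nzsect f))%N.
Proof.
move=> nz_a dv_f r_nz.
have uniq_nz : uniq (nzsect f) by rewrite filter_uniq ?iota_uniq.
have := r_nz; rewrite mem_filter mem_iota add0n => /andP[nz_h /andP[_ lt_rp]].
set c := size _; pose h := sect p r f.
(* The scalar by which the operators act on section [r]; residues below [p] stay distinct in [F]. *)
pose b := \prod_(r' <- rem r (nzsect f)) (r%:R - r'%:R) : F.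
have nz_b : b != 0.
  rewrite prodf_seq_neq0; apply/allP => r'.
  rewrite (mem_rem_uniq _ uniq_nz) !inE mem_filter mem_iota add0n.
  by case/and3P=> ne_r' _ /andP[_ lt_r'p]; rewrite subr_eq0 natF_inj // eq_sym.
have dv_g : ('X - a%:P) ^+ (k - size (rem r (nzsect f)))
              %| b *: ((h \Po 'X^p) * 'X^r).
  apply: dvdp_kill dv_f => n; rewrite coefZ coefMXn coef_comp_poly_Xn //.
  rewrite (divn_eq n p); set q := (n %/ p)%N; set r' := (n %% p)%N.
  have lt_r'p : (r' < p)%N by rewrite ltn_mod.
  have natE : (q * p + r')%:R = r'%:R :> F.
    by rewrite natrD natrM (pcharf0 pF) mulr0 add0r.
  under [in RHS]eq_bigr do rewrite natE.
  rewrite -[f`_ _]coef_sect //; have [eq_r|ne_r] := eqVneq r' r.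
    by rewrite eq_r ltnNge leq_addl addnK dvdn_mull // mulnK //= mulrC.
  rewrite [LHS](_ : _ = 0).
    have [->|nz_r'] := eqVneq (sect p r' f) 0; first by rewrite coef0 mul0r.
    rewrite (big_rem r') /= ?subrr ?mul0r ?mulr0 //.
    by rewrite mem_rem_uniq // !inE ne_r mem_filter nz_r' mem_iota.
  case: ltnP => [|le_r]; rewrite ?mulr0 // -eqn_mod_dvd // modnMDl.
  by rewrite !modn_small // (negbTE ne_r) mulr0.
move: dv_g; rewrite size_rem // -/c dvdpZr //.
(* As [a] is nonzero, the factor ['X^r] is coprime to ['X - a] and drops out. *)
rewrite Gauss_dvdpl; last first.
  apply: coprimep_expl; apply: coprimep_expr.
  by rewrite coprimep_sym coprimep_XsubC rootX.
have [m [q]] := multiplicity_XsubC h (a ^+ p).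
rewrite nz_h /= => nr_q def_h dv_h; exists m.
  by rewrite -/h def_h dvdp_mulIr.
(* Frobenius turns multiplicity [m] at [a ^+ p] into [p * m] at [a]; [q \Po 'X^p] does not vanish
   there. *)
have hE : h \Po 'X^p = (q \Po 'X^p) * ('X - a%:P) ^+ (p * m).
  have := exp_XnsubC 1 a 1; rewrite expn1 mul1n => Xp.
  rewrite def_h comp_polyM rmorphXn /= comp_polyB comp_polyX comp_polyC.
  by rewrite exprM Xp.
move: dv_h; rewrite hE Gauss_dvdpr; last first.
  apply: coprimep_expl; rewrite coprimep_sym coprimep_XsubC.
  by rewrite /root horner_comp hornerXn.
rewrite dvdp_Pexp2l ?size_XsubC // => le_k.
have : (0 < c)%N by rewrite /c; case: (nzsect f) r_nz.
lia.
Qed.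

Lemma nzsect_gt0 f : f != 0 -> (0 < size (nzsect f))%N.
Proof.
case/(sect_neq0 p_gt0) => r lt_rp nz_r.
by rewrite -has_predT; apply/hasP; exists r; rewrite // mem_filter nz_r mem_iota.
Qed.

Lemma size_nzsect f : (size (nzsect f) <= p)%N.
Proof. by rewrite size_filter (leq_trans (count_size _ _)) // size_iota. Qed.

Lemma wt_ge_nzsect f w : (forall r, r \in nzsect f -> w <= wt (sect p r f))%N ->
  (size (nzsect f) * w <= wt f)%N.
Proof.
move=> le_w; rewrite (wt_sect f p_gt0) (bigID (fun r => sect p r f != 0)) /=.
rewrite (leq_trans _ (leq_addr _ _)) // /index_iota subn0 -big_filter -/(nzsect f).
rewrite -sum1_size big_distrl /= big_seq [leqRHS]big_seq.
by apply: leq_sum => r /le_w; rewrite mul1n.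
Qed.

Lemma size_dvdp_exp_XsubC a k f : f != 0 -> ('X - a%:P) ^+ k %| f ->
  (k < size f)%N.
Proof. by move=> nz_f /(dvdp_leq nz_f); rewrite size_exp_XsubC. Qed.

(** Induction on [s] through the sections modulo [p]: the number [c] of nonzero ones is multiplied
    by a lower bound [w] on their weights. The last hypothesis bounds the gap [p ^ s - k], a form
    that passes on to the sections. *)
Lemma wt_ge s Ga ga k a f : a != 0 -> f != 0 -> (size f <= p ^ s)%N ->
  ('X - a%:P) ^+ k %| f -> (0 < Ga < p)%N -> (ga < s)%N ->
  (p ^ s - k < (p - Ga + 1) * p ^ (s - ga - 1))%N ->
  ((Ga + 1) * p ^ ga <= wt f)%N.
Proof.
elim: s Ga ga k a f => // s IHs Ga ga k a f nz_a nz_f le_f dv_f.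
move=> /andP[Ga_gt0 lt_Ga] le_ga lt_k.
have p_gt1 := prime_gt1 p_prime.
have c_gt0 := nzsect_gt0 nz_f; have c_le := size_nzsect f.
have k_lt := leq_trans (size_dvdp_exp_XsubC nz_f dv_f) le_f.
suff [w le_w le_cw] : exists2 w,
    forall r, r \in nzsect f -> (w <= wt (sect p r f))%N
    & ((Ga + 1) * p ^ ga <= size (nzsect f) * w)%N.
  exact: leq_trans (wt_ge_nzsect le_w).
have secP r : r \in nzsect f -> exists m,
  [/\ sect p r f != 0, (size (sect p r f) <= p ^ s)%N,
      ('X - (a ^+ p)%:P) ^+ m %| sect p r f, (m < p ^ s)%N
    & (k < p * m + size (nzsect f))%N].
  move=> r_nz; have [m dv_m lt_km] := dvdp_sect nz_a dv_f r_nz.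
  have nz_r : sect p r f != 0 by move: r_nz; rewrite mem_filter => /andP[].
  have le_s : (size (sect p r f) <= p ^ s)%N by rewrite size_sect // -expnS.
  exists m; split=> //.
  exact: leq_trans (size_dvdp_exp_XsubC nz_r dv_m) _.
have nz_ap : a ^+ p != 0 by rewrite expf_neq0.
(* The multiplicity in one section is kept aside, to bound [c] from below where no section is in
   scope. *)
have [m0 [_ _ _ lt_m0 lt_km0]] : exists m, [/\ True, True, True, m < p ^ s
    & k < p * m + size (nzsect f)]%N.
  case: (nzsect f) c_gt0 secP => // r rs _ /(_ r (mem_head _ _)) [m [_ _ _ ? ?]].
  by exists m.
move: (size (nzsect f)) c_gt0 c_le secP lt_km0 => c c_gt0 c_le secP lt_km0.
(* For [ga = s] the bounds force [c > Ga] and the exponent [p ^ s - 1] in every nonzero section,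
   whose [p ^ s] coefficients are then all nonzero by induction. *)
move: le_ga lt_k; rewrite ltnS leq_eqVlt => /predU1P[-> {ga}|lt_gas].
  rewrite subSnn subnn muln1 expnS => lt_k.
  exists (p ^ s)%N => [r /secP[m [nz_r le_r dv_m lt_m lt_km]]|]; last first.
    by rewrite leq_mul2r; apply/orP; right; nia.
  have eq_m : (p ^ s - m = 1)%N by nia.
  have [s0|s_gt0] := posnP s; first by rewrite s0 wt_gt0.
  have : ((p.-1 + 1) * p ^ s.-1 <= wt (sect p r f))%N.
    apply: (IHs _ _ m _ _ nz_ap nz_r le_r dv_m); lia.
  by rewrite addn1 prednK // -expnS prednK.
have -> : (s.+1 - ga - 1 = (s - ga - 1).+1)%N by lia.
have : (0 < p ^ (s - ga - 1))%N by rewrite expn_gt0 p_gt0.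
rewrite !expnS; set Q := (p ^ (s - ga - 1))%N => Q_gt0 lt_k.
(* A single nonzero section loses no multiplicity: the same [Ga] and [ga] serve for it. *)
have [c1|c_neq1] := eqVneq c 1%N.
  exists ((Ga + 1) * p ^ ga)%N; last by rewrite c1 mul1n.
  move=> r /secP[m [nz_r le_r dv_m lt_m lt_km]].
  apply: (IHs _ _ m _ _ nz_ap nz_r le_r dv_m); [lia|lia|rewrite -/Q].
  rewrite c1 in lt_km; rewrite -(ltn_pmul2l p_gt0).
  apply: leq_ltn_trans (_ : p * p ^ s - k < _)%N; first by lia.
  by rewrite mulnCA.
(* For [c >= 2] the next lower value suffices, as [2 * Ga >= Ga + 1]. It belongs to [Ga - 1] and
   [ga], or, when [Ga = 1] and [ga > 0], to [p - 1] and [ga - 1]. *)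
exists (Ga * p ^ ga)%N; last by nia.
move=> r /secP[m [nz_r le_r dv_m lt_m lt_km]].
have le_X : (p ^ s - m <= (p - Ga + 1) * Q)%N by nia.
have [Ga1|Ga_neq1] := eqVneq Ga 1%N; last first.
  rewrite -[Ga](subnK Ga_gt0).
  apply: (IHs _ _ m _ _ nz_ap nz_r le_r dv_m); [lia|lia|rewrite -/Q; nia].
rewrite Ga1 mul1n; case: ga => [|ga] in lt_gas Q Q_gt0 lt_k le_X *.
  by rewrite wt_gt0.
suff : ((p.-1 + 1) * p ^ ga <= wt (sect p r f))%N.
  by rewrite addn1 prednK // expnS.
apply: (IHs _ _ m _ _ nz_ap nz_r le_r dv_m); [lia|lia|].
have -> : (s - ga - 1 = (s - ga.+1 - 1).+1)%N by lia.
rewrite expnS -/Q; nia.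
Qed.

(** By Frobenius the power is a polynomial of degree [j] in ['X^(p ^ e)]. *)
Lemma wt_exp_XsubC_le a e j : (wt (('X - a%:P) ^+ (p ^ e * j)) <= j + 1)%N.
Proof.
have -> : ('X - a%:P) ^+ (p ^ e * j)
          = ('X - (a ^+ (p ^ e))%:P) ^+ j \Po 'X^(p ^ e).
  rewrite rmorphXn /= comp_polyB comp_polyX comp_polyC exprM.
  by rewrite -[X in X - a%:P]expr1 exp_XnsubC mul1n.
rewrite (leq_trans (wt_comp_Xn _ _)) // (leq_trans (wt_le_size _)) //.
by rewrite size_exp_XsubC addn1.
Qed.

Lemma wt_attained s Ga ga k a : a != 0 -> (0 < Ga < p)%N -> (ga < s)%N ->
  (k <= p ^ s - p ^ (s - ga) + Ga * p ^ (s - ga - 1))%N ->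
  exists f, [/\ f != 0, (size f <= p ^ s)%N, ('X - a%:P) ^+ k %| f
    & (wt f <= (Ga + 1) * p ^ ga)%N].
Proof.
move=> nz_a /andP[Ga_gt0 lt_Ga] lt_gas le_k.
set k0 := (_ + _)%N in le_k; exists (('X - a%:P) ^+ k0).
have eq_s : (p ^ s = p ^ (s - ga) * p ^ ga)%N by rewrite -expnD subnK // ltnW.
have eq_sga : (p ^ (s - ga) = p * p ^ (s - ga - 1))%N.
  by rewrite -expnS; congr (_ ^ _)%N; lia.
have Q_gt0 : (0 < p ^ (s - ga - 1))%N by rewrite expn_gt0 p_gt0.
have ga_gt0 : (0 < p ^ ga)%N by rewrite expn_gt0 p_gt0.
split; first by rewrite expf_neq0 // polyXsubC_eq0.
- by rewrite size_exp_XsubC /k0; nia.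
- exact: dvdp_exp2l.
(* The exponent is [p ^ (s - ga) * (p ^ ga - 1) + p ^ (s - ga - 1) * Ga]; the two factors have at
   most [p ^ ga] and [Ga + 1] terms. *)
rewrite /k0 eq_s -{2}[(p ^ (s - ga))%N]muln1 -mulnBr exprD.
rewrite (leq_trans (wtM _ _)) // mulnC; apply: leq_mul.
  by rewrite mulnC wt_exp_XsubC_le.
by rewrite (leq_trans (wt_exp_XsubC_le _ _ _)) // subn1 addn1 prednK.
Qed.

End PrimeChar.
End Weight.

(** * The ring F[u,v]/<u^2, v^2, uv - vu> and the pair distance *)

Section RingR.
Variable F : fieldType.

Definition piR : {rmorphism {poly {poly F}} -> ringR F} :=
  (\pi_({ideal_quot uv_idealr F}))%qT.

Definition embRM : {rmorphism F -> ringR F} := piR \o polyC \o polyC.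

Definition uvR : ringR F := uR F * vR F.

Lemma piR_surj (r : ringR F) : exists q, r = piR q.
Proof. by exists (repr r); rewrite -[LHS]reprK. Qed.

Lemma piR_eq0 q : piR q = 0 -> uv_ideal q.
Proof.
move=> q0; have : (q - 0 \in (uv_idealr F : pred _)).
  rewrite Quotient.idealrBE; apply/eqP; exact: etrans q0 (esym (rmorph0 piR)).
by rewrite subr0.
Qed.

Lemma uRR0 : uR F * uR F = 0.
Proof.
rewrite -[LHS]/(piR 'X%:P * piR 'X%:P) -rmorphM -(rmorph0 piR).
apply/eqP; rewrite /piR -Quotient.idealrBE subr0; apply/asboolP.
exists (fun i => (i == ord0)%:R); rewrite !big_ord_recl big_ord0 /=.
by rewrite mul1r !mul0r !addr0 expr2.
Qed.

Lemma vRR0 : vR F * vR F = 0.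
Proof.
rewrite -[LHS]/(piR 'X * piR 'X) -rmorphM -(rmorph0 piR).
apply/eqP; rewrite /piR -Quotient.idealrBE subr0; apply/asboolP.
exists (fun i => (i == lift ord0 ord0)%:R); rewrite !big_ord_recl big_ord0 /=.
by rewrite mul1r !mul0r !addr0 add0r expr2.
Qed.

Lemma uvR_u : uvR * uR F = 0.
Proof. by rewrite /uvR mulrAC uRR0 mul0r. Qed.

Lemma uvR_v : uvR * vR F = 0.
Proof. by rewrite /uvR -mulrA vRR0 mulr0. Qed.

(** Both [u] and [v] kill [uv], so only the constant term of a representative survives. *)
Lemma uvR_emb (r : ringR F) : exists c, uvR * r = uvR * embRM c.
Proof.
have [q ->] := piR_surj r; elim/poly_ind: q => [|q b _].
  by exists 0; rewrite !rmorph0.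
rewrite rmorphD rmorphM mulrDr mulrCA [piR 'X]/(vR F) uvR_v mulr0 add0r.
elim/poly_ind: b => [|b c _]; first by exists 0; rewrite !rmorph0.
exists c; rewrite polyCD polyCM rmorphD rmorphM mulrDr mulrCA.
by rewrite [piR 'X%:P]/(uR F) uvR_u mulr0 add0r.
Qed.

(** The coefficient of [uv] vanishes on every element of the relation ideal, so it can be read off
    in the quotient. *)
Lemma uvR_emb_inj : injective (fun c : F => uvR * embRM c).
Proof.
move=> c d /eqP; rewrite -subr_eq0 -mulrBr -rmorphB.
rewrite -[uvR * _]/(piR 'X%:P * piR 'X * piR (c - d)%:P%:P) -!rmorphM.
move=> /eqP/piR_eq0/asboolP[e] /(congr1 (fun q : {poly {poly F}} => q`_1`_1)).
rewrite mulrAC coefMX -polyCM coefC /= coefXM coefC /= !big_ord_recl big_ord0 /=.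
rewrite [X in e _ * (X - _)]mulrC subrr mulr0 !addr0 !coefD -rmorphXn coefMC.
by rewrite !coefMXn /= coef0 addr0 => /eqP; rewrite subr_eq0 => /eqP.
Qed.

End RingR.

Section PairDistance.
Variables (R : eqType) (n : nat).
Implicit Types (x y : 'rV[R]_n) (A : {set 'I_n}).

(** A differing position affects only its own pair and that of its predecessor. *)
Lemma sp_dist_le x y : (sp_dist x y <= 2 * #|[set i | (x 0 i != y 0 i)%R]|)%N.
Proof.
set D := [set i | _]; rewrite mul2n -addnn.
apply: leq_trans (leq_add (leqnn #|D|) (leq_imset_card (@ord_pred n) (mem D))).
apply: leq_trans (leq_card_setU _ _); apply: subset_leq_card.
apply/subsetP => i; rewrite !inE xpair_eqE negb_and => /orP[->//|ne].
by apply/orP; right; apply/imsetP; exists (ordS i); rewrite ?inE ?ordSK.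
Qed.

(** Having no two cyclically adjacent positions, [A] is disjoint from the set of its predecessors,
    and the pairs at both sets differ. *)
Lemma sp_dist_ge x y A :
  {in A, forall i, x 0 i != y 0 i} -> {in A, forall i, ordS i \notin A} ->
  (2 * #|A| <= sp_dist x y)%N.
Proof.
move=> neA isoA; set P := @ord_pred n @: A.
have injP : injective (@ord_pred n) by apply: can_inj (@ord_predK n).
have <- : #|A :|: P| = (2 * #|A|)%N.
  rewrite cardsU card_imset // mul2n -addnn (_ : A :&: P = set0) ?cards0 ?subn0 //.
  apply/setP => i; rewrite !inE; apply/negbTE/negP => /andP[Ai /imsetP[j Aj Ei]].
  by have := isoA i Ai; rewrite Ei ord_predK Aj.
apply: subset_leq_card; apply/subsetP => i; rewrite !inE xpair_eqE negb_and.
case/orP=> [/neA->//|/imsetP[j Aj ->]].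
by rewrite ord_predK (neA _ Aj) orbT.
Qed.

End PairDistance.

(** * The words of the code *)

Lemma ideal_gen1P (A : comNzRingType) (g c : A) :
  c \in ideal_gen [:: g] <-> exists a, c = a * g.
Proof.
split=> [/asboolP[a ->]|[a ->]].
  by exists (a ord0); rewrite big_ord_recl big_ord0 addr0.
by apply/asboolP; exists (fun=> a); rewrite big_ord_recl big_ord0 addr0.
Qed.

(* [R], [e], [u], [v] stand for [ringR F], [embR], [uR], [vR]: with the concrete
   quotient ring, unification diverges on polynomials over it. *)
Section Codewords.
Variables (F : fieldType) (R : comNzRingType) (e : {rmorphism F -> R}).
Variables (u v z : R).
Implicit Types f g q : {poly F}.
Hypotheses (uu0 : u * u = 0) (zu0 : z * u = 0) (zv0 : z * v = 0).
Hypothesis zE : z = u * v.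
Hypothesis z_e : forall r, exists c, z * r = z * e c.
Hypothesis z_inj : injective (fun c => z * e c).
Variables (p s : nat) (pF : p \in [pchar F]).
Variables (a0 a1 a2 a3 a4 : F) (a1E : a0 ^+ (p ^ s) = a1) (a3_neq0 : a3 != 0).
Variables (alpha : R) (alphaE : alpha = e a1 + e a2 * u + e a3 * v + e a4 * z).

Local Notation N := (2 * p ^ s)%N.
Local Notation P := ('X^2 - a0%:P : {poly F}).
Local Notation m := ('X^N - alpha%:P : {poly R}).
Local Notation A := (consta_ring N alpha).
Local Notation lift := (map_poly e).

Let N_gt0 : (0 < N)%N.
Proof. by rewrite muln_gt0 expn_gt0 (prime_gt0 (pcharf_prime pF)). Qed.

Let mk_m : mk_monic m = m.
Proof. by rewrite /mk_monic size_XnsubC // ltnS N_gt0 monicXnsubC. Qed.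

Let in_qpoly_mul_m (q : {poly R}) : in_qpoly m (q * m) = 0.
Proof.
apply: val_inj; rewrite /= mk_m; apply: Pdiv.RingMonic.rmodp_mull.
exact: monicXnsubC.
Qed.

Let in_qpoly_m (q : {poly R}) : (size q <= N)%N -> in_qpoly m q = q :> {poly R}.
Proof. by move=> le_q; rewrite in_qpoly_small // mk_m size_XnsubC. Qed.

Let PpE : P ^+ (p ^ s) = 'X^N - a1%:P.
Proof. by rewrite (exp_XnsubC pF) a1E. Qed.

Let lift_PpE : lift (P ^+ (p ^ s)) = 'X^N - (e a1)%:P.
Proof. by rewrite PpE rmorphB /= map_polyXn map_polyC. Qed.

Let liftP : lift P = 'X^2 - (e a0)%:P.
Proof. by rewrite rmorphB /= map_polyXn map_polyC. Qed.

(** [alpha] and [e a1] agree after multiplication by [z], so words [z * f] may be reduced modulo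
    ['X^N - a1] over [F]. *)
Lemma in_qpoly_z_lift q : in_qpoly m (z%:P * lift (q * ('X^N - a1%:P))) = 0.
Proof.
have zalpha : z * alpha = z * e a1.
  have zz0 : z * z = 0 by rewrite {2}zE mulrA zu0 mul0r.
  by rewrite alphaE !mulrDr ![z * (e _ * _)]mulrCA zu0 zv0 zz0 !mulr0 !addr0.
rewrite -PpE [lift _]rmorphM /= lift_PpE mulrCA mulrBr -polyCM -zalpha polyCM.
rewrite -mulrBr mulrA.
exact: in_qpoly_mul_m.
Qed.

(** Since [u * u = 0], the product [u * alpha] keeps only the terms in [a1] and [a3]; the latter is
    what remains modulo [m]. *)
Lemma in_qpoly_u_lift :
  in_qpoly m (u%:P * lift P ^+ (p ^ s)) = in_qpoly m (z * e a3)%:P.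
Proof.
have ualpha : u * alpha = u * e a1 + z * e a3.
  rewrite alphaE zE !mulrDr ![u * (e _ * _)]mulrCA [u * (u * v)]mulrA.
  rewrite uu0 mul0r !mulr0 !addr0.
  by rewrite [e a3 * _]mulrC.
have -> : u%:P * lift P ^+ (p ^ s) = u%:P * m + (z * e a3)%:P.
  rewrite -rmorphXn /= lift_PpE !mulrBr -!polyCM ualpha polyCD opprD addrA.
  by rewrite addrNK.
by rewrite in_qpolyD in_qpoly_mul_m add0r.
Qed.

Lemma z_lift (a : {poly R}) :
  exists f : {poly F}, z%:P * a = z%:P * lift f.
Proof.
elim/poly_ind: a => [|a r [f Ef]]; first by exists 0; rewrite rmorph0.
have [c Ec] := z_e r; exists (f * 'X + c%:P).
rewrite rmorphD rmorphM /= map_polyX map_polyC.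
by rewrite !mulrDr mulrA Ef mulrA -!polyCM Ec.
Qed.

Definition word (f : {poly F}) : 'rV[R]_N := \row_i (z * e f`_i).

Lemma word_eq f g i : (word f 0 i == word g 0 i) = (f`_i == g`_i).
Proof. by rewrite !mxE; apply: (inj_eq z_inj). Qed.

Lemma wordE f : word f = poly_rV (z%:P * lift f).
Proof. by apply/rowP => i; rewrite !mxE coefCM coef_map. Qed.

Lemma size_zlift (f : {poly F}) : (size f <= N)%N ->
  (size (z%:P * lift f)%R <= N)%N.
Proof.
move=> le_f; rewrite mul_polyC (leq_trans (size_scale_leq _ _)) //.
by rewrite (leq_trans (size_poly _ _)).
Qed.

Definition gen l : A := in_qpoly m (u%:P * ('X^2 - (e a0)%:P) ^+ l).
Definition code l : 'rV[R]_N -> Prop := consta_code (ideal_gen [:: gen l]).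

(** The inequality serves both [l <= p ^ s], with [k = 0], and [l = p ^ s + k]. *)
Lemma mem_code l k (f : {poly F}) : (l <= p ^ s + k)%N -> (size f <= N)%N ->
  P ^+ k %| f -> code l (word f).
Proof.
move=> le_l le_f /dvdpP[q def_f].
exists (in_qpoly m (z%:P * lift f)); last by rewrite wordE in_qpoly_m ?size_zlift.
apply/ideal_gen1P.
(* The extra power raises [l] to [p ^ s + k], and [a3^-1] cancels the scalar coming from
   [u * P ^+ (p ^ s)]. *)
exists (in_qpoly m (lift (a3^-1 *: q) * lift P ^+ (p ^ s + k - l))).
rewrite /gen -liftP -in_qpolyM.
have -> : lift (a3^-1 *: q) * lift P ^+ (p ^ s + k - l) * (u%:P * lift P ^+ l)
   = lift (a3^-1 *: q) * lift P ^+ k * (u%:P * lift P ^+ (p ^ s)).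
  rewrite -!mulrA; congr (_ * _).
  by rewrite mulrCA -exprD subnK // addnC exprD mulrCA.
rewrite [in RHS]in_qpolyM in_qpoly_u_lift -[in RHS]in_qpolyM.
congr (in_qpoly _ _); rewrite -[lift P ^+ k]rmorphXn -[lift _ * lift _]rmorphM.
rewrite polyCM mulrCA; congr (_ * _).
rewrite -map_polyC -rmorphM /= def_f; congr (lift _).
by rewrite [RHS]mulrC mul_polyC -scalerAl scalerA mulfV // scale1r.
Qed.

Lemma code_word k w : (k <= p ^ s)%N -> code (p ^ s + k) w ->
  exists f : {poly F}, [/\ (size f <= N)%N, P ^+ k %| f & w = word f].
Proof.
move=> le_k [c /ideal_gen1P[a ->] ->].
have [b ->] : exists b : {poly R}, a = in_qpoly m b.
  exists (a : {poly R}); apply: val_inj.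
  by rewrite /= Pdiv.CommonRing.rmodp_small // size_mk_monic.
have [q Eq] := z_lift b.
(* The modulus is [P ^+ (p ^ s)] and [k <= p ^ s], so the remainder is still divisible by
   [P ^+ k]. *)
pose f := (q * (a3 *: P ^+ k)) %% ('X^N - a1%:P).
have le_f : (size f <= N)%N.
  by rewrite -ltnS -(size_XnsubC a1 N_gt0) ltn_modp -size_poly_eq0 size_XnsubC.
exists f; split=> //.
  by rewrite /f -dvdp_mod ?dvdp_mull ?dvdpZr // -PpE dvdp_exp2l.
rewrite wordE -(in_qpoly_m (size_zlift le_f)); congr (poly_rV (val _)).
rewrite /gen -liftP exprD mulrA [in_qpoly m (_ * _)]in_qpolyM in_qpoly_u_lift.
rewrite -!in_qpolyM.
have -> : b * ((z * e a3)%:P * lift P ^+ k) = z%:P * lift (q * (a3 *: P ^+ k)).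
  rewrite polyCM -mulrA mulrCA mulrA Eq -mulrA rmorphM /=; congr (_ * (_ * _)).
  by rewrite -mul_polyC rmorphM /= map_polyC rmorphXn.
rewrite {1}(divp_eq (q * _) ('X^N - a1%:P)) rmorphD mulrDr in_qpolyD.
by rewrite in_qpoly_z_lift add0r.
Qed.

(** * Pair distances between codewords *)

Lemma word_inj f g : (size f <= N)%N -> (size g <= N)%N ->
  word f = word g -> f = g.
Proof.
move=> le_f le_g /rowP eq_fg; apply/polyP => i.
have [lt_iN|le_Ni] := ltnP i N.
  by apply/eqP; rewrite -(word_eq _ _ (Ordinal lt_iN)) eq_fg.
by rewrite !nth_default // (leq_trans _ le_Ni).
Qed.

Lemma sp_dist_word_le f g : (size f <= N)%N -> (size g <= N)%N ->
  (sp_dist (word f) (word g) <= 2 * wt (f - g))%N.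
Proof.
move=> le_f le_g; rewrite -(@wt_card _ N); last first.
  by rewrite (leq_trans (size_polyD _ _)) // geq_max le_f size_polyN.
rewrite (leq_trans (sp_dist_le _ _)) // leq_mul2l /=.
apply: subset_leq_card; apply/subsetP => i; rewrite !inE word_eq.
by rewrite coefB subr_eq0.
Qed.

(** The length is even, so the wrap-around changes the parity too. *)
Lemma val_ordS_mod2 (i : 'I_N) : (ordS i = (i + 1) %[mod 2])%N.
Proof. by rewrite /= modn_dvdm ?dvdn_mulr // addn1. Qed.

Lemma sp_dist_word_ge r f g : (r < 2)%N -> (size f <= N)%N -> (size g <= N)%N ->
  (2 * wt (sect 2 r (f - g)%R) <= sp_dist (word f) (word g))%N.
Proof.
move=> lt_r2 le_f le_g.
pose A := [set i : 'I_N | (i %% 2 == r)%N && ((f - g)%R`_i != 0)].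
apply: (@leq_trans (2 * #|A|)).
  rewrite leq_mul2l /=; apply: wt_sect_card => //.
  by rewrite (leq_trans (size_polyD _ _)) // geq_max le_f size_polyN.
apply: sp_dist_ge => i; rewrite !inE => /andP[/eqP par nz].
  by rewrite word_eq -subr_eq0 -coefB.
rewrite negb_and val_ordS_mod2 -modnDml par.
by case: r {A par} lt_r2 => [|[|]].
Qed.

Lemma dvdp_sect2 k r f : (r < 2)%N -> P ^+ k %| f ->
  ('X - a0%:P) ^+ k %| sect 2 r f.
Proof.
move=> lt_r2 /dvdpP[q ->]; rewrite mulrC.
have -> : P ^+ k = ('X - a0%:P) ^+ k \Po 'X^2.
  by rewrite rmorphXn /= comp_polyB comp_polyX comp_polyC.
by rewrite sect_comp_XnM // dvdp_mulIl.
Qed.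

(** One differing position is never its own successor and so spoils two pairs; the word of the
    polynomial 1 attains this. *)
Lemma is_min_sp_dist_small l : (l <= p ^ s)%N -> is_min_sp_dist (code l) 2.
Proof.
move=> le_l; have sz1 : (size (1 : {poly F})%R <= N)%N by rewrite size_poly1.
have sz0 : (size (0 : {poly F})%R <= N)%N by rewrite size_poly0.
have ge2 (x y : 'rV[R]_N) : x <> y -> (2 <= sp_dist x y)%N.
  move=> ne_xy.
  have [i ne_i] : exists i : 'I_N, x 0 i != y 0 i.
    apply/existsP; apply: contra_notT ne_xy => /existsPn eq_xy.
    by apply/rowP => i; apply/eqP; rewrite -[_ == _]negbK eq_xy.
  suff: (2 * #|[set i]| <= sp_dist x y)%N by rewrite cards1.
  apply: sp_dist_ge => j.
    by rewrite inE => /eqP->.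
  rewrite !inE => /eqP->{j}; apply/eqP => /(congr1 (fun j : 'I_N => j %% 2)%N).
  rewrite val_ordS_mod2 addn1 -[in RHS](addn0 i) -addn1 => /eqP.
  by rewrite eqn_modDl.
have ne10 : word 1 <> word 0.
  by move/(word_inj sz1 sz0)/eqP; rewrite oner_eq0.
split=> [|x y _ _]; last exact: ge2.
exists (word 1), (word 0); split=> //.
- by apply: (mem_code (k := 0)); rewrite ?addn0 ?expr0 ?dvd1p.
- by apply: (mem_code (k := 0)); rewrite ?addn0 ?expr0 ?dvd1p.
apply/eqP; rewrite eqn_leq ge2 // andbT (leq_trans (sp_dist_word_le _ _)) //.
by have := wt_le_size (1 : {poly F}); rewrite subr0 size_poly1; lia.
Qed.

Lemma is_min_sp_dist_large k Ga ga : a0 != 0 -> (k <= p ^ s)%N ->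
  (0 < Ga < p)%N -> (ga < s)%N ->
  (p ^ s - p ^ (s - ga) + (Ga - 1) * p ^ (s - ga - 1) + 1 <= k)%N ->
  (k <= p ^ s - p ^ (s - ga) + Ga * p ^ (s - ga - 1))%N ->
  is_min_sp_dist (code (p ^ s + k)) (2 * (Ga + 1) * p ^ ga).
Proof.
move=> nz_a0 le_k Ga_lt ga_lt k_ge k_le.
have p_gt0 : (0 < p)%N by rewrite (prime_gt0 (pcharf_prime pF)).
have lower f g : (size f <= N)%N -> (size g <= N)%N ->
    P ^+ k %| f -> P ^+ k %| g -> f != g ->
    (2 * (Ga + 1) * p ^ ga <= sp_dist (word f) (word g))%N.
  move=> le_f le_g dv_f dv_g; rewrite -subr_eq0 => nz_fg.
  have [r lt_r nz_r] := sect_neq0 (isT : 0 < 2)%N nz_fg.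
  apply: leq_trans (sp_dist_word_ge lt_r le_f le_g).
  rewrite -mulnA leq_mul2l /=.
  apply: (wt_ge pF (s := s) (k := k) (a := a0)) => //.
  - apply: size_sect => //.
    by rewrite (leq_trans (size_polyD _ _)) // geq_max le_f size_polyN.
  - by apply: dvdp_sect2 => //; rewrite dvdp_sub.
  have eq_sga : (p ^ (s - ga) = p * p ^ (s - ga - 1))%N.
    by rewrite -expnS; congr (_ ^ _)%N; lia.
  have : (p ^ (s - ga) <= p ^ s)%N by rewrite leq_pexp2l ?leq_subr.
  have : (0 < p ^ (s - ga - 1))%N by rewrite expn_gt0 p_gt0.
  case/andP: Ga_lt => Ga_gt0 Ga_lt; move: k_ge; rewrite eq_sga.
  move: (p ^ s)%N (p ^ (s - ga - 1))%N => S Q.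
  (* This identity turns the lower end of the range of [k] into the bound on [p ^ s - k]; with the
     products abstracted the goal is linear. *)
  have : ((p - Ga + 1) * Q + (Ga - 1) * Q = p * Q)%N.
    by rewrite -mulnDl; congr muln; lia.
  have : (0 < Q -> 0 < (p - Ga + 1) * Q)%N by rewrite muln_gt0 addn1.
  move: ((p - Ga + 1) * Q)%N ((Ga - 1) * Q)%N (p * Q)%N; lia.
split=> [|x y]; last first.
  move=> /(code_word le_k)[f [le_f dv_f ->]] /(code_word le_k)[g [le_g dv_g ->]].
  move=> ne_fg; apply: lower => //; apply: contra_notN ne_fg => /eqP->.
  by [].
have [f [nz_f le_f dv_f wt_f]] := wt_attained pF nz_a0 Ga_lt ga_lt k_le.
(* Substituting ['X^2] spreads the extremal polynomial over even positions and turns ['X - a0] into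
   [P]. *)
pose h := f \Po 'X^2.
have le_h : (size h <= N)%N.
  rewrite (leq_trans (size_comp_poly_leq _ _)) // size_polyXn /=.
  move: nz_f le_f; rewrite -size_poly_gt0; move: (size f) (p ^ s)%N; lia.
have nz_h : h != 0.
  apply: contraNneq nz_f => h0; apply/eqP/polyP => j.
  have := coef_comp_poly_Xn f (j * 2) (isT : 0 < 2)%N.
  by rewrite -/h h0 !coef0 dvdn_mull // mulnK.
have dv_h : P ^+ k %| h.
  case/dvdpP: dv_f => q def_f.
  rewrite /h def_f comp_polyM rmorphXn /= comp_polyB comp_polyX comp_polyC.
  exact: dvdp_mulIr.
have sz0 : (size (0 : {poly F})%R <= N)%N by rewrite size_poly0.
have dist : (sp_dist (word h) (word 0) = 2 * (Ga + 1) * p ^ ga)%N.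
  apply/eqP; rewrite eqn_leq lower ?dvdp0 // andbT.
  rewrite (leq_trans (sp_dist_word_le _ _)) // subr0 -mulnA leq_mul2l /=.
  exact: leq_trans (wt_comp_Xn _ _) wt_f.
exists (word h), (word 0); split=> //.
- exact: (mem_code (k := k)).
- by apply: (mem_code (k := k)); rewrite ?dvdp0.
by move/(word_inj le_h sz0)/eqP; rewrite (negbTE nz_h).
Qed.

End Codewords.

(* [p - Ga] is the leading base-[p] digit of [2 * p ^ s - l], and [s - ga - 1]
   its position. *)
Lemma range_cover p s l : prime p -> (p ^ s < l <= 2 * p ^ s - 1)%N ->
  exists Ga ga, [/\ (1 <= Ga <= p - 1)%N, (0 <= ga <= s - 1)%N &
        (2 * p ^ s - p ^ (s - ga) + (Ga - 1) * p ^ (s - ga - 1) + 1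
           <= l
           <= 2 * p ^ s - p ^ (s - ga) + Ga * p ^ (s - ga - 1))%N].
Proof.
move=> p_prime /andP[lt_l le_l]; have p_gt1 := prime_gt1 p_prime.
pose t := (2 * p ^ s - l)%N; have t_gt0 : (0 < t)%N by rewrite /t; lia.
have t_lt : (t < p ^ s)%N by rewrite /t; lia.
have /andP[le_t lt_t] := trunc_log_bounds p_gt1 t_gt0.
set e := trunc_log p t in le_t lt_t.
have lt_es : (e < s)%N by rewrite -(ltn_exp2l _ _ p_gt1) (leq_ltn_trans le_t).
pose q := (t %/ p ^ e)%N; have E_gt0 : (0 < p ^ e)%N by rewrite expn_gt0 ltnW.
have q_gt0 : (0 < q)%N by rewrite divn_gt0.
have q_lt : (q < p)%N by rewrite ltn_divLR // -expnS.
have q_le : (q * p ^ e <= t)%N by apply: leq_divM.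
have q_ge : (t < q.+1 * p ^ e)%N by apply: ltn_ceil.
exists (p - q)%N, (s - e.+1)%N; split; [lia | lia |].
have -> : (s - (s - e.+1) = e.+1)%N by lia.
have -> : (e.+1 - 1 = e)%N by lia.
have le_eS : (p ^ e.+1 <= p ^ s)%N by rewrite leq_exp2l.
have E1 : ((p - q) * p ^ e + q * p ^ e = p * p ^ e)%N.
  by rewrite -mulnDl subnK // ltnW.
have E2 : ((p - q - 1) * p ^ e + q.+1 * p ^ e = p * p ^ e)%N.
  by rewrite -mulnDl; congr muln; lia.
move: le_eS E1 E2 q_le q_ge t_lt lt_l le_l; rewrite expnS /t.
move: ((p - q) * p ^ e)%N (q * p ^ e)%N ((p - q - 1) * p ^ e)%N.
move: (q.+1 * p ^ e)%N (p * p ^ e)%N (p ^ s)%N.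
lia.
Qed.

Theorem theorem5p2 (p m s : nat) (F : finFieldType)
    (alpha1 alpha2 alpha3 alpha4 alpha0 : F) (l : nat) :
  prime p -> odd p -> (0 < m)%N -> (0 < s)%N -> #|F| = (p ^ m)%N ->
  alpha1 != 0 -> alpha2 != 0 -> alpha3 != 0 ->
  let alpha : ringR F :=
    embR alpha1 + embR alpha2 * uR F + embR alpha3 * vR F
    + embR alpha4 * (uR F * vR F) in
  ~ (exists beta : ringR F, alpha = beta ^+ 2) ->
  alpha0 ^+ (p ^ s) = alpha1 ->
  (0 <= l <= 2 * p ^ s - 1)%N ->
  let g : consta_ring (2 * p ^ s) alpha :=
    in_qpoly _ ((uR F)%:P * ('X^2 - (embR alpha0)%:P) ^+ l) in
  let C := consta_code (ideal_gen [:: g]) in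
  let in_case (Gamma gamma : nat) :=
    [/\ (1 <= Gamma <= p - 1)%N, (0 <= gamma <= s - 1)%N &
        (2 * p ^ s - p ^ (s - gamma) + (Gamma - 1) * p ^ (s - gamma - 1) + 1
           <= l
           <= 2 * p ^ s - p ^ (s - gamma) + Gamma * p ^ (s - gamma - 1))%N] in
  [/\ (0 <= l <= p ^ s)%N -> is_min_sp_dist C 2,
      forall Gamma gamma : nat, in_case Gamma gamma ->
        is_min_sp_dist C (2 * (Gamma + 1) * p ^ gamma)
    & ~~ (0 <= l <= p ^ s)%N ->
        exists Gamma gamma : nat, in_case Gamma gamma].
Proof.
move=> p_prime _ _ s_gt0 cardF nz_a1 _ nz_a3 alpha _ a0E le_l g C in_case.
have pF := card_finPcharP cardF p_prime.
have nz_a0 : alpha0 != 0.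
  apply: contraNneq nz_a1 => a00.
  by rewrite -a0E a00 expr0n expn_eq0 eqn0Ngt prime_gt0.
have alphaE : alpha = embRM F alpha1 + embRM F alpha2 * uR F
  + embRM F alpha3 * vR F + embRM F alpha4 * uvR F by [].
split=> [le_ls|Ga ga [Ga_le ga_le /andP[l_ge l_le]]|nle].
- exact: (is_min_sp_dist_small (uRR0 F) (erefl : uvR F = uR F * vR F)
    (@uvR_emb_inj F) pF a0E nz_a3 alphaE le_ls).
- have p_gt1 := prime_gt1 p_prime.
  have le_P : (p ^ (s - ga) <= p ^ s)%N by rewrite leq_pexp2l ?leq_subr ?prime_gt0.
  (* The case forces [l > p ^ s], since [p ^ (s - ga) <= p ^ s], so the truncated subtraction is
     exact. *)
  have [k def_l] : exists k, l = (p ^ s + k)%N by exists (l - p ^ s)%N; lia.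
  rewrite /C /g def_l.
  apply: (is_min_sp_dist_large (uRR0 F) (uvR_u F) (uvR_v F)
    (erefl : uvR F = uR F * vR F) (@uvR_emb F) (@uvR_emb_inj F) pF a0E nz_a3 alphaE) => //; lia.
by apply: range_cover => //; lia.
Qed.
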